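(* Suppose that the MDP is unichain and the environment is oblivious (it chooses a fixed sequence $\boldsymbol f=(f_1,\dots,f_T)\in\mathcal F^T$ not depending on states and actions). Let $\mathcal G'$ be a nonempty subset of the state-action polytope $\mathcal G$. Then for any admissible relaxation $\widehat V_T(\mathcal G'|\cdot)$ and the corresponding behavioral strategy $\widehat{\boldsymbol\gamma}$, for every initial state $x\in\mathsf X$ and every $\boldsymbol f\in\mathcal F^T$, $$\mathbb E_x^{\widehat{\boldsymbol\gamma},\boldsymbol f}\Big[\sum_{t=1}^Tf_t(X_t,U_t)\Big]-\inf_{P\in\mathcal M(\mathcal G')}\sum_{t=1}^T\langle\pi_P\otimes P,f_t\rangle\le\widehat V_T(\mathcal G'|\mathsf e)+C_{\mathcal F}\sum_{t=1}^T\|\mu_t-\pi_t\|_1,$$ where $\mathsf e$ is the empty tuple, $C_{\mathcal F}=\sup_{f\in\mathcal F}\|f\|_\infty$, $\mu_t$ is the distribution of $X_t$ under $(\widehat{\boldsymbol\gamma},\boldsymbol f)$ with $X_1=x$, and $\pi_t=\pi_{P_t}$ is the invariant distribution of $K(\cdot|\cdot,P_t)$, with $P_t$ the state feedback law used by $\widehat{\boldsymbol\gamma}$ at time $t$.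
   Context: $\mathsf X,\mathsf U$ are finite nonempty sets (states, actions); $K(y|x,u)$ is a fixed transition kernel; $\mathcal P(\cdot)$ denotes the set of probability distributions on a finite set; $\mathcal M(\mathsf U|\mathsf X)$ is the set of Markov matrices $P=[P(u|x)]$, $P(\cdot|x)\in\mathcal P(\mathsf U)$. For $P\in\mathcal M(\mathsf U|\mathsf X)$, $K(y|x,P)=\sum_uK(y|x,u)P(u|x)$. The MDP is unichain if for every $P\in\mathcal M(\mathsf U|\mathsf X)$ the chain with kernel $K(\cdot|\cdot,P)$ has a single recurrent class, equivalently a unique invariant distribution, denoted $\pi_P$. $(\pi\otimes P)(x,u)=\pi(x)P(u|x)$; $\langle\nu,f\rangle=\sum_{x,u}\nu(x,u)f(x,u)$; $\|\cdot\|_1$ is the $\ell_1$ norm. $\mathcal F$ is a fixed nonempty class of functions $\mathsf X\times\mathsf U\to\mathbb R$, uniformly bounded ($C_{\mathcal F}<\infty$), and $T\ge1$ is a fixed horizon. Game: $X_1=x$. For $t=1,\dots,T$: the agent, using a state feedback law $P_t\in\mathcal M(\mathsf U|\mathsf X)$ that depends only on $f_1,\dots,f_{t-1}$, observes $X_t$ and draws $U_t\sim P_t(\cdot|X_t)$; $f_t\in\mathcal F$ is revealed; the cost $f_t(X_t,U_t)$ is incurred; then $X_{t+1}\sim K(\cdot|X_t,U_t)$. $\mathbb E_x^{\boldsymbol\gamma,\boldsymbol f}$ is the resulting expectation when the agent uses strategy $\boldsymbol\gamma$. State-action polytope (ergodic occupation measures): $\mathcal G=\{\nu\in\mathcal P(\mathsf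 X\times\mathsf U):\sum_{x,u}K(y|x,u)\nu(x,u)=\sum_u\nu(y,u)\ \forall y\in\mathsf X\}$. Each $\nu\in\mathcal G$ induces a policy $P_\nu(u|x)=\nu(x,u)/\sum_{v}\nu(x,v)$ at states $x$ where the denominator is nonzero; at the other states $P_\nu(\cdot|x)$ is set to an arbitrary fixed element of $\mathcal P(\mathsf U)$. $\mathcal M(\mathcal G')=\{P_\nu:\nu\in\mathcal G'\}$. An admissible relaxation is a family of functions $\widehat V_T(\mathcal G'|f_1,\dots,f_t)\in\mathbb R$, defined for $t=0,\dots,T$ and $f_1,\dots,f_t\in\mathcal F$, such that for all $f_1,\dots,f_T\in\mathcal F$ $$\widehat V_T(\mathcal G'|f_1,\dots,f_t)\ge\inf_{\nu\in\mathcal G'}\sup_{f\in\mathcal F}\{\langle\nu,f\rangle+\widehat V_T(\mathcal G'|f_1,\dots,f_t,f)\},\quad t=T-1,\dots,0,$$ $$\widehat V_T(\mathcal G'|f_1,\dots,f_T)\ge-\inf_{\nu\in\mathcal G'}\sum_{t=1}^T\langle\nu,f_t\rangle .$$ The corresponding behavioral strategy $\widehat{\boldsymbol\gamma}$ chooses at time $t$ $$\nu_t\in\operatorname*{arg\,min}_{\nu\in\mathcal G'}\sup_{f\in\mathcal F}\{\langle\nu,f\rangle+\widehat V_T(\mathcal G'|f_1,\dots,f_{t-1},f)\}$$ (minimizers are assumed to exist) and uses the state feedback law $P_t=P_{\nu_t}$. *)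

(* Defs.v *)
From mathcomp Require Import all_boot all_order all_algebra.
From mathcomp Require Import boolp classical_sets reals ereal.

Set Implicit Arguments.
Unset Strict Implicit.
Unset Printing Implicit Defensive.

Import Order.TTheory GRing.Theory Num.Theory.
Local Open Scope classical_set_scope.
Local Open Scope ring_scope.

Section Dist.
Context {R : realType} {T : finType}.

Definition is_dist (p : T -> R) : Prop :=
  (forall t, 0 <= p t) /\ \sum_t p t = 1.

Definition dirac_dist (x : T) : T -> R := fun y => (y == x)%:R.

Definition norm1 (g : T -> R) : R := \sum_t `|g t|.

Definition norm_oo (g : T -> R) : R := \big[Num.max/0]_t `|g t|.

Definition pairing (nu g : T -> R) : R := \sum_t nu t * g t.

End Dist.

(* Conditional probabilities are written with the conditioning variables first:
   K x u y is K(y|x,u) and P x u is P(u|x). *)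
Section MDP.
Context {R : realType} {X U : finType}.
Implicit Types (K : X -> U -> X -> R) (P : X -> U -> R).

Definition is_kernel K : Prop := forall x u, is_dist (K x u).

Definition is_policy P : Prop := forall x, is_dist (P x).

Definition chain K P (x y : X) : R := \sum_u K x u y * P x u.

(* In a finite chain a state is recurrent iff it is accessible from each state
   that is accessible from it; accessibility is connect over the transitions of
   positive probability. *)
Definition accessible (k : X -> X -> R) : rel X := connect (fun x y => 0 < k x y).

Definition recurrent (k : X -> X -> R) (x : X) : bool :=
  [forall y, accessible k x y ==> accessible k y x].

Definition recurrent_class (k : X -> X -> R) (C : {set X}) : Prop :=
  exists2 x, recurrent k x &
    C = [set y | accessible k x y && accessible k y x]%SET.

Definition unichain K : Prop :=
  forall P, is_policy P -> exists! C : {set X}, recurrent_class (chain K P) C.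

Definition invariant_dist (k : X -> X -> R) (p : X -> R) : Prop :=
  is_dist p /\ forall y, \sum_x p x * k x y = p y.

(* pi_P; meaningful when the invariant distribution exists and is unique, as it
   is for every policy of a unichain MDP. *)
Definition inv_dist K P : X -> R :=
  xget (fun=> 0) [set p | invariant_dist (chain K P) p].

Definition otimes (p : X -> R) P : X * U -> R := fun z => p z.1 * P z.1 z.2.

Definition state_action_polytope K : set (X * U -> R) :=
  [set nu | is_dist nu /\
    forall y, \sum_x \sum_u K x u y * nu (x, u) = \sum_u nu (y, u)].

(* P_nu; q is the fixed law used at the states of zero nu-mass. *)
Definition induced_policy (q : U -> R) (nu : X * U -> R) : X -> U -> R :=
  fun x u => if \sum_v nu (x, v) == 0 then q u
             else nu (x, u) / \sum_v nu (x, v).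

End MDP.

Section Game.
Context {R : realType} {X U : finType}.
Local Notation cost := (X * U -> R).

(* A strategy maps the costs revealed so far to the next state feedback law. *)
Definition strategy := seq cost -> X -> U -> R.

(* Probability that the remaining state-action pairs are w, when the current
   state has law p, the costs h have been revealed and the costs fs remain to be
   revealed, one per round. *)
Fixpoint traj_prob (K : X -> U -> X -> R) (gamma : strategy) (p : X -> R)
    (h fs : seq cost) (w : seq (X * U)) : R :=
  match fs, w with
  | [::], [::] => 1
  | f :: fs', (x, u) :: w' =>
      p x * gamma h x u * traj_prob K gamma (K x u) (rcons h f) fs' w'
  | _, _ => 0
  end.

Definition expectation (K : X -> U -> X -> R) (gamma : strategy) (x : X)
    (T : nat) (f : T.-tuple cost) (Z : T.-tuple (X * U) -> R) : R :=
  \sum_(w : T.-tuple (X * U))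
    traj_prob K gamma (dirac_dist x) [::] f w * Z w.

(* Rounds are numbered from 0 and t : 'I_T is round t.+1 of the usual numbering,
   so that take t f lists the costs revealed before round t. *)
Definition state_law (K : X -> U -> X -> R) (gamma : strategy) (x : X)
    (T : nat) (f : T.-tuple cost) (t : 'I_T) (y : X) : R :=
  expectation K gamma x f (fun w => ((tnth w t).1 == y)%:R).

Definition sup_norm_class (F : set cost) : R := sup [set norm_oo f | f in F].

(* Extended real: V is not assumed bounded in the newly revealed cost. *)
Definition worst_case (F : set cost) (V : seq cost -> R) (h : seq cost)
    (nu : X * U -> R) : \bar R :=
  ereal_sup [set (pairing nu f + V (rcons h f))%:E | f in F].

(* Only the values of V at sequences in F of length at most T matter. *)
Definition admissible_relaxation (F : set cost) (G' : set (X * U -> R))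
    (T : nat) (V : seq cost -> R) : Prop :=
  (forall h : seq cost, [set` h] `<=` F -> (size h < T)%N ->
     (ereal_inf [set worst_case F V h nu | nu in G'] <= (V h)%:E)%E) /\
  (forall h : seq cost, [set` h] `<=` F -> size h = T ->
     - inf [set \sum_(f <- h) pairing nu f | nu in G'] <= V h).

Definition is_minimizing_selection (F : set cost) (G' : set (X * U -> R))
    (T : nat) (V : seq cost -> R) (nu : seq cost -> X * U -> R) : Prop :=
  forall h : seq cost, [set` h] `<=` F -> (size h < T)%N ->
    G' (nu h) /\
    forall nu', G' nu' -> (worst_case F V h (nu h) <= worst_case F V h nu')%E.

Definition behavioral_strategy (q : U -> R) (nu : seq cost -> X * U -> R) :
  strategy := fun h => induced_policy q (nu h).

End Game.

Arguments strategy : clear implicits.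

(* Main.v *)
(* In a unichain MDP each nu in the polytope equals pi_P (x) P for P = P_nu: its
   state marginal is invariant for P, hence is pi_P by uniqueness. So the
   comparator is the infimum of sum_t <nu, f_t> over nu in G', and telescoping
   the relaxation inequalities along f bounds the regret of the nu_t by V(e).
   The expected cost of round t is <mu_t (x) P_t, f_t>, which differs from
   <nu_t, f_t> = <pi_t (x) P_t, f_t> by at most ||f_t|| ||mu_t - pi_t||_1. *)
Require Import Defs.
From mathcomp Require Import all_boot all_order all_algebra.
From mathcomp Require Import boolp classical_sets reals ereal.

Set Implicit Arguments.
Unset Strict Implicit.
Unset Printing Implicit Defensive.

Import Order.TTheory GRing.Theory Num.Theory.
Local Open Scope classical_set_scope.
Local Open Scope ring_scope.

Lemma sum_pair {R : realType} {X U : finType} (h : X * U -> R) :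
  \sum_z h z = \sum_x \sum_u h (x, u).
Proof. by rewrite pair_bigA; apply: eq_bigr => -[]. Qed.

(** * Recurrent classes and uniqueness of the invariant distribution *)

Section RecurrentStates.
Context {R : realType} {X : finType}.
Implicit Types (k : X -> X -> R) (S : {set X}).

Lemma accessible_closed k S x y :
  (forall a b, a \in S -> 0 < k a b -> b \in S) ->
  x \in S -> accessible k x y -> y \in S.
Proof.
move=> clS xS /connectP[p pth ->]; elim: p x xS pth => //= z p IH x xS.
by case/andP=> kxz /IH; apply; apply: clS kxz.
Qed.

(* A state of S from which the fewest states are accessible is recurrent. *)
Lemma closed_set_recurrent k S x0 :
  (forall a b, a \in S -> 0 < k a b -> b \in S) ->
  x0 \in S -> exists2 x, x \in S & recurrent k x.
Proof.
move=> clS x0S.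
case: (arg_minnP (fun x => #|accessible k x|) x0S) => x xS minx.
exists x => //; apply/forallP => y; apply/implyP => xy.
have yS := accessible_closed clS xS xy.
have sub : accessible k y \subset accessible k x.
  by apply/fintype.subsetP => z; apply: connect_trans.
(* Minimality of [x] over [S] turns the inclusion into an equality of accessible sets, and [x] lies
   in its own. *)
have /subset_cardP eqyx : #|accessible k y| = #|accessible k x|.
  by apply/eqP; rewrite eqn_leq subset_leq_card // minx.
by have := eqyx sub x; rewrite [RHS]connect0.
Qed.

(** By invariance [p b] is at least the single inflow [p a * k a b]. The total mass of [p] is left
    free, so that parts of a difference of distributions qualify. *)
Lemma nonneg_invariant_support_closed k (p : X -> R) :
  (forall x y, 0 <= k x y) -> (forall x, 0 <= p x) ->
  (forall y, \sum_x p x * k x y = p y) ->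
  forall a b, a \in [set x | 0 < p x]%SET -> 0 < k a b ->
    b \in [set x | 0 < p x]%SET.
Proof.
move=> k0 p0 pk a b; rewrite !inE => pa kab; rewrite -pk (bigD1 a) //=.
by rewrite ltr_pwDl ?mulr_gt0 // sumr_ge0 // => i _; rewrite mulr_ge0.
Qed.

(* The triangle inequality gives |d| <= |d| k pointwise, and both sides have the
   same total mass. *)
Lemma abs_invariant k (d : X -> R) :
  (forall x y, 0 <= k x y) -> (forall x, \sum_y k x y = 1) ->
  (forall y, \sum_x d x * k x y = d y) ->
  forall y, \sum_x `|d x| * k x y = `|d y|.
Proof.
move=> k0 k1 dk.
have le y : `|d y| <= \sum_x `|d x| * k x y.
  rewrite -{1}dk; apply: le_trans (ler_norm_sum _ _ _) _.
  by apply: ler_sum => x _; rewrite normrM (ger0_norm (k0 _ _)).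
have sum0 : \sum_y (\sum_x `|d x| * k x y - `|d y|) = 0.
  rewrite sumrB exchange_big /= -sumrB big1 // => x _.
  by rewrite -mulr_sumr k1 mulr1 subrr.
move=> y; apply/eqP; rewrite -subr_eq0.
by move: sum0 => /psumr_eq0P -> // i _; rewrite subr_ge0.
Qed.

(* The supports of the positive and negative parts of p - p' are disjoint and
   closed, and would each contain a recurrent class if p and p' differed. *)
Lemma invariant_dist_unique k (p p' : X -> R) :
  (forall x y, 0 <= k x y) -> (forall x, \sum_y k x y = 1) ->
  (exists! C : {set X}, recurrent_class k C) ->
  invariant_dist k p -> invariant_dist k p' -> p = p'.
Proof.
move=> k0 k1 [C [_ uniqC]] [[_ p1] pk] [[_ p'1] p'k].
pose d x := p x - p' x.
have d0 : \sum_x d x = 0 by rewrite sumrB p1 p'1 subrr.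
have dk y : \sum_x d x * k x y = d y.
  rewrite -[RHS]/(p y - p' y) -pk -p'k -sumrB.
  by apply: eq_bigr => x _; rewrite mulrBl.
have adk := abs_invariant k0 k1 dk.
(* Twice the positive and negative parts of [d], invariant because [|d|] and [d] both are. *)
pose pos x := `|d x| + d x; pose neg x := `|d x| - d x.
have pos0 x : 0 <= pos x by rewrite -lerBlDr sub0r -normrN ler_norm.
have neg0 x : 0 <= neg x by rewrite subr_ge0 ler_norm.
have posk y : \sum_x pos x * k x y = pos y.
  rewrite /pos -[in RHS]adk -[in RHS](dk y) -big_split.
  by apply: eq_bigr => x _; rewrite mulrDl.
have negk y : \sum_x neg x * k x y = neg y.
  rewrite /neg -[in RHS]adk -[in RHS](dk y) -sumrB.
  by apply: eq_bigr => x _; rewrite mulrBl.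
have mass (e : X -> R) : (forall x, 0 <= e x) -> ~~ [exists x, 0 < e x] ->
    \sum_x e x = 0.
  move=> e0 /existsPn e_le0; apply: big1 => x _; apply/eqP.
  by rewrite eq_le e0 andbT leNgt.
(* As [d] has total mass 0, [pos] and [neg] both carry the mass of [|d|]; if either vanishes, then
   [p = p']. *)
have sumpos : \sum_x pos x = \sum_x `|d x| by rewrite big_split /= d0 addr0.
have sumneg : \sum_x neg x = \sum_x `|d x| by rewrite sumrB d0 subr0.
have abs0 : \sum_x `|d x| = 0 -> p = p'.
  move=> s0; apply/funext => x; apply/eqP; rewrite -subr_eq0 -normr_eq0.
  by move/psumr_eq0P: s0 => ->.
have [/existsP[a pa]|/(mass _ pos0)] := boolP [exists x, 0 < pos x]; last first.
  by rewrite sumpos.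
have [/existsP[b nb]|/(mass _ neg0)] := boolP [exists x, 0 < neg x]; last first.
  by rewrite sumneg.
have clp := nonneg_invariant_support_closed k0 pos0 posk.
have cln := nonneg_invariant_support_closed k0 neg0 negk.
have [|x xS rx] := @closed_set_recurrent _ _ a clp; first by rewrite inE.
have [|y yS ry] := @closed_set_recurrent _ _ b cln; first by rewrite inE.
(* Both recurrent states generate [C], so [y] is accessible from [x] and lies in both closed
   supports. *)
have Cx := uniqC _ (ex_intro2 _ _ x rx erefl).
have Cy := uniqC _ (ex_intro2 _ _ y ry erefl).
have : y \in C by rewrite Cy inE /accessible connect0.
rewrite Cx inE => /andP[/(accessible_closed clp xS) + _].
(* At [y] both [d y] and [- d y] would be strictly below [|d y|]. *)
move: yS; rewrite !inE subr_gt0 /pos => dy; rewrite -ltrBlDr sub0r => dy'.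
by have := ltxx `|d y|; rewrite ltr_norml dy ltrNl dy'.
Qed.

End RecurrentStates.

(** * Occupation measures, their induced policies, and cost perturbation *)

Section OccupationMeasures.
Context {R : realType} {X U : finType}.
Implicit Types (K : X -> U -> X -> R) (P : X -> U -> R) (nu : X * U -> R).

Lemma chain_ge0 K P : is_kernel K -> is_policy P ->
  forall x y, 0 <= chain K P x y.
Proof.
move=> hK hP x y; apply: sumr_ge0 => u _.
by rewrite mulr_ge0 //; [case: (hK x u)|case: (hP x)].
Qed.

Lemma chain_sum1 K P : is_kernel K -> is_policy P ->
  forall x, \sum_y chain K P x y = 1.
Proof.
move=> hK hP x; rewrite exchange_big /= -(proj2 (hP x)).
by apply: eq_bigr => u _; rewrite -mulr_suml (proj2 (hK x u)) mul1r.
Qed.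

(** Nothing is asked of [nu], so this covers the strategy at every history, including those outside
    [F] where the selection is unconstrained. *)
Lemma sum_induced_policy (q : U -> R) nu x :
  \sum_u q u = 1 -> \sum_u induced_policy q nu x u = 1.
Proof.
rewrite /induced_policy => q1; case: eqP => [//|/eqP s0].
by rewrite -mulr_suml divff.
Qed.

Lemma induced_policy_is_policy (q : U -> R) nu :
  is_dist q -> is_dist nu -> is_policy (induced_policy q nu).
Proof.
move=> [q0 q1] [nu0 _] x; split; last exact: sum_induced_policy.
move=> u; rewrite /induced_policy; case: eqP => // _.
by rewrite divr_ge0 // sumr_ge0.
Qed.

(** Where the marginal vanishes, nonnegativity forces [nu (x, u) = 0], so the default law [q] has no
    effect. *)
Lemma otimes_induced_policy (q : U -> R) nu : (forall z, 0 <= nu z) ->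
  otimes (fun y => \sum_u nu (y, u)) (induced_policy q nu) = nu.
Proof.
move=> nu0; apply/funext => -[x u]; rewrite /otimes /induced_policy /=.
case: eqP => [s0|/eqP s0]; last by rewrite mulrCA divff ?mulr1.
by rewrite s0 mul0r; move/psumr_eq0P: s0 => ->.
Qed.

(** Once [nu] is factored as marginal times induced policy, the balance equation of the polytope is
    the invariance equation. *)
Lemma marginal_invariant K (q : U -> R) nu : state_action_polytope K nu ->
  invariant_dist (chain K (induced_policy q nu)) (fun y => \sum_u nu (y, u)).
Proof.
move=> [[nu0 nu1] bal]; split; first split.
- by move=> y; apply: sumr_ge0.
- by rewrite -sum_pair.
move=> y; rewrite -bal; apply: eq_bigr => x _; rewrite mulr_sumr.
apply: eq_bigr => u _; rewrite mulrCA; congr (_ * _).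
by have := congr1 (@^~ (x, u)) (@otimes_induced_policy q nu nu0).
Qed.

Lemma otimes_inv_dist K (q : U -> R) nu :
  is_kernel K -> unichain K -> is_dist q -> state_action_polytope K nu ->
  otimes (inv_dist K (induced_policy q nu)) (induced_policy q nu) = nu.
Proof.
move=> hK huni hq hnu; have [nud _] := hnu.
have hP := induced_policy_is_policy hq nud.
have minv := marginal_invariant q hnu.
suff -> : inv_dist K (induced_policy q nu) = fun y => \sum_u nu (y, u).
  by apply: otimes_induced_policy; case: nud.
have uniq := invariant_dist_unique (chain_ge0 hK hP) (chain_sum1 hK hP) (huni _ hP).
apply: uniq => //.
(* Existence of an invariant distribution ensures that [xget] does not return its default 0. *)
exact: xgetI minv.
Qed.

Lemma norm_oo_ge (T : finType) (g : T -> R) z : `|g z| <= norm_oo g.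
Proof. exact: (le_bigmax_cond _ (fun z => `|g z|)). Qed.

(** Each law [P x] has mass 1, so averaging over actions keeps the l1 distance between the state
    laws. *)
Lemma pairing_otimesB_le (p p' : X -> R) P (g : X * U -> R) :
  is_policy P ->
  pairing (otimes p P) g - pairing (otimes p' P) g
    <= norm_oo g * norm1 (fun y => p y - p' y).
Proof.
move=> hP; rewrite /pairing -sumrB /norm1 mulr_sumr.
rewrite sum_pair.
apply: ler_sum => x _; have [P0 P1] := hP x.
rewrite -[leRHS]mulr1 -P1 mulr_sumr; apply: ler_sum => u _.
rewrite /otimes /= -mulrBl -mulrBl; apply: le_trans (ler_norm _) _.
rewrite !normrM (ger0_norm (P0 u)) [leLHS]mulrC mulrA.
by rewrite ler_wpM2r // ler_wpM2r // norm_oo_ge.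
Qed.

Lemma norm_oo_le_sup (F : set (X * U -> R)) g :
  (exists C : R, forall f, F f -> forall z, `|f z| <= C) -> F g ->
  norm_oo g <= sup_norm_class F.
Proof.
move=> [C hC] Fg; apply: ub_le_sup; last by exists g.
(* [norm_oo] is a maximum started at 0, while [C] might be negative. *)
exists (Num.max 0 C) => _ [h Fh <-]; apply: bigmax_le.
  by rewrite le_max lexx.
by move=> z _; rewrite le_max hC ?orbT.
Qed.

End OccupationMeasures.

(** * Trajectory law and expected cost of each round *)

Section Trajectories.
Context {R : realType} {X U : finType}.
Local Notation cost := (X * U -> R).

Lemma sum_tuple_cons (A : finType) n (H : n.+1.-tuple A -> R) :
  \sum_w H w = \sum_a \sum_(w : n.-tuple A) H [tuple of a :: w].
Proof.
rewrite pair_bigA /=.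
rewrite (reindex (fun z : A * n.-tuple A => [tuple of z.1 :: z.2])) //=.
exists (fun w => (thead w, [tuple of behead w])) => [[a w] _|w _] /=.
  by congr pair; apply: val_inj.
by rewrite -tuple_eta.
Qed.

Variables (K : X -> U -> X -> R) (gamma : strategy R X U).
Hypotheses (hK : is_kernel K) (hgamma : forall h y, \sum_u gamma h y u = 1).

Lemma sum_traj_prob n (fs : n.-tuple cost) (p : X -> R) h :
  \sum_y p y = 1 ->
  \sum_(w : n.-tuple (X * U)) traj_prob K gamma p h fs w = 1.
Proof.
elim: n fs p h => [|n IH] fs p h p1.
  rewrite (big_pred1 [tuple]) => [|w]; first by rewrite (tuple0 fs).
  by apply/esym/eqP; apply: tuple0.
case/tupleP: fs => c fs; rewrite sum_tuple_cons /= -p1.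
rewrite sum_pair.
apply: eq_bigr => x _; rewrite -[RHS]mulr1 -(hgamma h x) mulr_sumr.
apply: eq_bigr => u _; rewrite -mulr_sumr IH ?mulr1 //.
by case: (hK x u).
Qed.

(** This is conditioning on the state of round [t]: the environment is oblivious, so the law used
    there is fixed by [h ++ take t fs]. The induction moves the first cost into the history until
    [t] is the current round, after which the future sums to 1. *)
Lemma sum_traj_prob_tnth n (fs : n.-tuple cost) (p : X -> R) h (t : 'I_n)
    (g : X * U -> R) :
  \sum_(w : n.-tuple (X * U)) traj_prob K gamma p h fs w * g (tnth w t) =
  \sum_(w : n.-tuple (X * U)) traj_prob K gamma p h fs w *
    \sum_u gamma (h ++ take t fs) (tnth w t).1 u * g ((tnth w t).1, u).
Proof.
elim: n fs p h t => [|n IH] fs p h t; first by case: t.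
case/tupleP: fs => c fs; rewrite !sum_tuple_cons.
case: (unliftP ord0 t) => [t' ->|->] /=; last first.
  rewrite cats0 !sum_pair; apply: eq_bigr => x _.
  (* On the right-hand side [S] does not depend on the first action, whose weights then sum to 1. *)
  pose S := \sum_u gamma h x u * g (x, u).
  transitivity (\sum_u p x * gamma h x u * g (x, u)).
    apply: eq_bigr => u _; rewrite -[RHS]mulr1.
    rewrite -(sum_traj_prob fs (rcons h c) (proj2 (hK x u))) mulr_sumr.
    by apply: eq_bigr => w _; rewrite tnth0 mulrAC.
  transitivity (p x * S).
    by rewrite mulr_sumr; apply: eq_bigr => u _; rewrite mulrA.
  rewrite -[LHS]mulr1 -(hgamma h x) mulr_sumr; apply: eq_bigr => u _.
  rewrite -[LHS]mulr1 -(sum_traj_prob fs (rcons h c) (proj2 (hK x u))) mulr_sumr.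
  by apply: eq_bigr => w _; rewrite tnth0 /= (mulrAC (p x) S) [RHS]mulrAC.
apply: eq_bigr => -[x u] _.
transitivity (p x * gamma h x u *
  \sum_(w : n.-tuple (X * U))
    traj_prob K gamma (K x u) (rcons h c) fs w * g (tnth w t')).
  by rewrite mulr_sumr; apply: eq_bigr => w _; rewrite tnthS mulrA.
rewrite IH mulr_sumr; apply: eq_bigr => w _.
by rewrite tnthS cat_rcons mulrA.
Qed.

Lemma expectation_cost x T (f : T.-tuple cost) :
  expectation K gamma x f (fun w => \sum_(t < T) tnth f t (tnth w t)) =
  \sum_(t < T)
    pairing (otimes (state_law K gamma x f t) (gamma (take t f))) (tnth f t).
Proof.
rewrite /expectation.
under eq_bigr do rewrite mulr_sumr.
rewrite exchange_big /=; apply: eq_bigr => t _; rewrite sum_traj_prob_tnth /=.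
rewrite /pairing /otimes.
rewrite sum_pair.
under [RHS]eq_bigr do
  (under eq_bigr do rewrite /= -mulrA; rewrite -mulr_sumr mulr_suml).
rewrite exchange_big /=; apply: eq_bigr => w _.
under [RHS]eq_bigr do rewrite -mulrA.
(* The indicator in [state_law] keeps only the state visited by [w] at round [t]. *)
rewrite -mulr_sumr (bigD1 (tnth w t).1) //= eqxx mul1r.
rewrite [X in _ = _ * (_ + X)]big1 ?addr0 // => y ny.
by rewrite eq_sym (negbTE ny) mul0r.
Qed.

End Trajectories.

(** * Telescoping the relaxation inequalities *)

Section Relaxations.
Context {R : realType} {X U : finType}.
Local Notation cost := (X * U -> R).
Variables (F : set cost) (G' : set cost) (T : nat) (V : seq cost -> R).
Variable nu : seq cost -> cost.
Hypotheses (hV : admissible_relaxation F G' T V)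
           (hnu : is_minimizing_selection F G' T V nu).

(** The minimizer [nu h] attains the infimum that [V h] dominates, and its worst case over [F]
    dominates the value at [c]. *)
Lemma relaxation_step (h : seq cost) (c : cost) :
  [set` h] `<=` F -> (size h < T)%N -> F c ->
  pairing (nu h) c + V (rcons h c) <= V h.
Proof.
move=> hF sh Fc; rewrite -lee_fin; have [_ minh] := hnu hF sh.
apply: le_trans (proj1 hV h hF sh).
apply: (@le_trans _ _ (worst_case F V h (nu h))).
  by apply: ereal_sup_ubound; exists c.
by apply: le_ereal_inf_tmp => _ [nu' /minh + <-].
Qed.

Lemma relaxation_telescope (f : T.-tuple cost) : [set` f] `<=` F ->
  \sum_(t < T) pairing (nu (take t f)) (tnth f t) + V f <= V [::].
Proof.
move=> hf.
(* Generalized to the first [n] rounds for induction; at [n = T] the prefix is all of [f]. *)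
suff H n : (n <= T)%N ->
    \sum_(0 <= t < n) pairing (nu (take t f)) (nth (fun=> 0) f t) + V (take n f)
      <= V [::].
  have := H _ (leqnn T); rewrite big_mkord.
  rewrite take_oversize ?size_tuple //.
  by under eq_bigr do rewrite -tnth_nth.
elim: n => [|n IH] nT; first by rewrite big_geq // add0r take0.
rewrite big_nat_recr //= -addrA; apply: le_trans (IH (ltnW nT)).
have nf : (n < size f)%N by rewrite size_tuple.
rewrite lerD2l (take_nth (fun=> 0)) //; apply: relaxation_step.
- by move=> c /= /mem_take; apply: hf.
- by rewrite size_takel ?size_tuple // ltnW.
- by apply: hf; apply: mem_nth.
Qed.

End Relaxations.

Theorem theorem2 (R : realType) (X U : finType)
  (hX : (0 < #|X|)%N) (hU : (0 < #|U|)%N)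
  (K : X -> U -> X -> R) (hK : is_kernel K) (huni : unichain K)
  (F : set (X * U -> R)) (hF0 : F !=set0)
  (hFb : exists C : R, forall f, F f -> forall z, `|f z| <= C)
  (T : nat) (hT : (0 < T)%N)
  (q : U -> R) (hq : is_dist q)
  (G' : set (X * U -> R)) (hG0 : G' !=set0)
  (hG : G' `<=` state_action_polytope K)
  (V : seq (X * U -> R) -> R) (hV : admissible_relaxation F G' T V)
  (nu : seq (X * U -> R) -> X * U -> R)
  (hnu : is_minimizing_selection F G' T V nu)
  (x : X) (f : T.-tuple (X * U -> R)) (hf : [set` f] `<=` F) :
  let gamma := behavioral_strategy q nu in
  let P_ (t : 'I_T) := gamma (take t f) in
  expectation K gamma x f (fun w => \sum_(t < T) tnth f t (tnth w t))
    - inf [set \sum_(t < T) pairing (otimes (inv_dist K P) P) (tnth f t)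
          | P in [set induced_policy q nu' | nu' in G']]
  <= V [::] + sup_norm_class F *
       \sum_(t < T) norm1 (fun y => state_law K gamma x f t y
                                    - inv_dist K (P_ t) y).
Proof.
cbv zeta; set gamma := behavioral_strategy q nu.
pose P_ (t : 'I_T) := gamma (take t f).
have take_F t : [set` take t f] `<=` F.
  by move=> c /= /mem_take; apply: hf.
have nuG (t : 'I_T) : G' (nu (take t f)).
  have tT : (size (take t f) < T)%N.
    by rewrite size_takel ?size_tuple // ltnW.
  by have [] := hnu _ (take_F t) tT.
have occ nu' : G' nu' ->
    otimes (inv_dist K (induced_policy q nu')) (induced_policy q nu') = nu'.
  by move=> /hG; apply: otimes_inv_dist.
have gamma1 h y : \sum_u gamma h y u = 1.
  by apply: sum_induced_policy; case: hq.
rewrite (expectation_cost hK gamma1).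
set I := inf _.
(* By [occ] the comparator over induced policies is the infimum over [G'] in the terminal
   admissibility condition. *)
have lastV : - I <= V f.
  have := proj2 hV f hf (size_tuple f); congr (- inf _ <= _).
  rewrite image_comp; apply: eq_imagel => nu' Gnu'.
  by rewrite big_tuple; apply: eq_bigr => t _; rewrite /= occ.
have teleV := relaxation_telescope hV hnu hf.
have step (t : 'I_T) :
    pairing (otimes (state_law K gamma x f t) (P_ t)) (tnth f t) <=
    pairing (nu (take t f)) (tnth f t) +
    sup_norm_class F *
      norm1 (fun y => state_law K gamma x f t y - inv_dist K (P_ t) y).
  (* With the played measure written as its invariant law times its policy, both pairings share the
     policy [P_ t] and differ only in the state law. *)
  rewrite -lerBlDl -{1}(occ _ (nuG t)).
  have [nud _] := hG _ (nuG t).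
  apply: le_trans (pairing_otimesB_le _ _ _ (induced_policy_is_policy hq nud)) _.
  apply: ler_wpM2r; first by apply: sumr_ge0.
  by apply: norm_oo_le_sup => //; apply: hf; apply: mem_tnth.
rewrite lerBlDr; apply: le_trans (ler_sum _ (fun t _ => step t)) _.
rewrite big_split /= -mulr_sumr [leRHS]addrAC lerD2r.
by rewrite -lerBlDr (le_trans _ teleV) // lerD2l.
Qed.
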